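(* Let $\mathcal T$ be an M-template of minimal Taylor algebras and $P=(V,D,\mathcal C)$, $D=\{\mathbf A_i:i\in V\}$, an SI-instance of $CSP(\mathcal T)$. Let $P/\overline{\mu}$ be the instance obtained from $P$ by factoring every large centralizer domain $\mathbf A_i$ by its monolith congruence $\mu_i$, and leaving all other domains of variables unchanged. Suppose that for every $i\in V$ and every point $a$ in the domain of $i$ in $P/\overline{\mu}$ (so $a$ is a $\mu_i$-class if $\mathbf A_i$ is a large centralizer domain, and an element of $A_i$ otherwise), $P/\overline{\mu}$ has a solution $f_a$ such that $f_a(i)=a$. Then there exists a retractive consistent set of maps $\{p_i:i\in V\}$ for $P$ such that each large centralizer domain $\mathbf A_i$ which has an s-edge is mapped onto a proper retract, i.e. $p_i(A_i)\subsetneq A_i$. In particular, if $\mathcal T$ is an M-template of minimal Taylor algebras, $P=(V,D,\mathcal C)$ is an SI-instance of $CSP(\mathcal T)$ such that for every $j\in V$ and every point $a$ in the domain of $j$ in $P/\overline{\mu}$ the instance $P/\overline{\mu}$ has a solution $f_a$ with $f_a(j)=a$, and if $\mathbf A_i$ is a large centralizer domain of $P$ and $\mathbf B_i\lhd_2\mathbf A_i$, then $P$ has a solution iff $P$ has a solution $f$ such that $f(i)\in B_i$.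
   Context: All algebras are finite and idempotent. A Taylor term is an idempotent term satisfying a finite set of equations not satisfied by any projection on a set with more than one element. A finite algebra $\mathbf A$ is minimal Taylor if it has a Taylor term and each Taylor term operation of $\mathbf A$ generates the whole clone of term operations of $\mathbf A$. An M-template is a class $\mathcal T$ of isomorphism types of similar finite algebras closed under homomorphic images, subalgebras and unary polynomial retracts (for a unary polynomial $p$ of $\mathbf A$ with $p\circ p=p$, the retract $p(\mathbf A)$ has universe $p(A)$ and operations $p\circ f$ restricted to $p(A)$, $f$ a basic operation of $\mathbf A$). A (multisorted) instance of $CSP(\mathcal T)$ is a triple $P=(V,D,\mathcal C)$, where $V$ is a finite set of variables, $D=\{\mathbf A_i:i\in V\}$ with each domain $\mathbf A_i$ isomorphic to an algebra in $\mathcal T$, and $\mathcal C$ is a set of constraints $(S,R)$ with $S\subseteq V$ and $R\le\prod_{i\in S}\mathbf A_i$ a subdirect product. A solution is $f\in\prod_{i\in V}A_i$ with $f|_S\in R$ for every $(S,R)\in\mathcal C$. An SI-instance is one in which every domain $\mathbf A_i$ is subdirectly irreducible; $\mu_i$ is its monolith (least nonzero congruence). Factoring a domain replaces $\mathbf A_i$ by $\mathbf A_i/\mu_i$ and each constraint relation by its image under the corresponding coordinatewise quotient maps. For congruences, the centralizer condition $C(\alpha,\beta;\delta)$ holds if for every term $t(\bar x,\bar y)$ and all tuples $\bar a,\bar b,\bar c,\bar d$ with $a_k\mathrel{\alpha}b_k$ and $c_k\mathrel{\beta}d_k$ for all $k$: $t(\bar a,\bar c)\mathrel{\delta}t(\bar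 a,\bar d)$ implies $t(\bar b,\bar c)\mathrel{\delta}t(\bar b,\bar d)$. The domain $\mathbf A_i$ is a large centralizer domain if $C(1_{\mathbf A_i},\mu_i;0_{\mathbf A_i})$ holds, where $1$ and $0$ denote the full and the equality congruence. A set of maps $\{p_i:i\in V\}$ is consistent with $P$ if each $p_i$ is a unary polynomial of $\mathbf A_i$ and for every constraint $(S,R)$ and every $r\in R$, $\langle p_i(r_i):i\in S\rangle\in R$. It is retractive if $p_i\circ p_i=p_i$ for all $i\in V$. $\mathbf A$ has an s-edge if there are $a\ne b$ in $A$ with $a\rightarrow_s b$, i.e. there is a binary term $t$ acting on $\{a,b\}$ as a semilattice operation with absorbing element $b$. $\mathbf B\lhd_2\mathbf A$ means that $\mathbf B$ is a (nonempty) subalgebra of $\mathbf A$ and there is a binary term operation $t$ of $\mathbf A$ with $t(x,y)\in B$ whenever $x,y\in A$ and at least one of $x,y$ is in $B$. *)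

(* Defs.v *)
From HB Require Import structures.
From mathcomp Require Import all_boot.
From mathcomp Require Import boolp.

Set Implicit Arguments.
Unset Strict Implicit.
Unset Printing Implicit Defensive.

Record signature := Signature { op : Type; ar : op -> nat }.

Section Terms.
Variable sig : signature.

Inductive term (X : Type) : Type :=
| Var of X
| App (o : op sig) of ('I_(ar o) -> term X).

Definition interpretation (A : Type) :=
  forall o : op sig, {ffun 'I_(ar o) -> A} -> A.

Fixpoint eval_in (A X : Type) (I : interpretation A) (v : X -> A)
    (t : term X) : A :=
  match t with
  | Var x => v x
  | App o ts => I o [ffun k => eval_in I v (ts k)]
  end.

End Terms.

Record algebra (sig : signature) := Algebra {
  carrier :> finType;
  interp : interpretation sig carrier;
  algebra_nonempty : 0 < #|carrier|;
  algebra_idem : forall (o : op sig) (x : carrier), interp [ffun _ : 'I_(ar o) => x] = x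
}.

Section Algebras.
Variable sig : signature.
Implicit Types A B : algebra sig.

Definition eval A (X : Type) (v : X -> A) (t : term sig X) : A :=
  eval_in (@interp sig A) v t.

Definition term_op A n (t : term sig 'I_n) : {ffun 'I_n -> A} -> A :=
  fun v => eval v t.

Definition binary_op A (t : term sig 'I_2) (x y : A) : A :=
  eval (fun k : 'I_2 => if val k == 0 then x else y) t.

Definition hom A B (h : A -> B) : Prop :=
  forall (o : op sig) (v : {ffun 'I_(ar o) -> A}),
    h (interp v) = interp [ffun k => h (v k)].

Definition isomorphic A B : Prop :=
  exists h : A -> B, hom h /\ bijective h.

Definition subuniverse A (B : {set A}) : Prop :=
  B != set0 /\
  forall (o : op sig) (v : {ffun 'I_(ar o) -> A}),
    (forall k, v k \in B) -> interp v \in B.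

(* Variable [None], with the elements of [A] as constants [Some a]. *)
Definition unary_polynomial A (p : A -> A) : Prop :=
  exists t : term sig (option A), forall x, p x = eval (odflt x) t.

End Algebras.

(* [one_op n] has a single n-ary symbol; an equation over it is a condition on
   one n-ary operation, which can thus be tested on an arbitrary set. *)
Definition one_op (n : nat) : signature :=
  @Signature unit (fun _ => n).

Definition one_op_interp (n : nat) (A : Type) (f : {ffun 'I_n -> A} -> A) :
  interpretation (one_op n) A := fun _ => f.

Definition equation (n : nat) : Type :=
  (term (one_op n) nat * term (one_op n) nat)%type.

Definition satisfies n (A : Type) (f : {ffun 'I_n -> A} -> A)
    l (E : 'I_l -> equation n) : Prop :=
  forall (e : 'I_l) (v : nat -> A),
    eval_in (one_op_interp f) v (E e).1 = eval_in (one_op_interp f) v (E e).2.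

Definition projection n (A : Type) (k : 'I_n) : {ffun 'I_n -> A} -> A :=
  fun v => v k.

Definition taylor_op n (A : Type) (f : {ffun 'I_n -> A} -> A) : Prop :=
  (forall x, f [ffun _ => x] = x) /\
  exists l (E : 'I_l -> equation n),
    satisfies f E /\
    forall (X : Type) (k : 'I_n),
      (exists x y : X, x <> y) -> ~ satisfies (@projection n X k) E.

Definition in_clone n (A : Type) (f : {ffun 'I_n -> A} -> A)
    m (g : {ffun 'I_m -> A} -> A) : Prop :=
  exists t : term (one_op n) 'I_m,
    forall v : {ffun 'I_m -> A}, g v = eval_in (one_op_interp f) v t.

Section MoreAlgebras.
Variable sig : signature.
Implicit Types A B : algebra sig.

Definition taylor_term A n (t : term sig 'I_n) : Prop :=
  taylor_op (@term_op sig A n t).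

Definition minimal_taylor A : Prop :=
  (exists n (t : term sig 'I_n), taylor_term A t) /\
  forall n (t : term sig 'I_n), taylor_term A t ->
    forall m (s : term sig 'I_m),
      in_clone (@term_op sig A n t) (@term_op sig A m s).

Section Retract.
Variables (A : algebra sig) (p : A -> A).
Hypothesis pp : forall x, p (p x) = p x.

Definition retract_carrier : finType := {x : A | x \in codom p}.

Definition retract_interp : interpretation sig retract_carrier :=
  fun o v => exist _ (p (interp [ffun k => val (v k)])) (codom_f p _).

Lemma retract_nonempty : 0 < #|retract_carrier|.
Proof.
have /card_gt0P[x _] := algebra_nonempty A.
by apply/card_gt0P; exists (exist _ (p x) (codom_f p x)).
Qed.

Lemma retract_idem (o : op sig) (x : retract_carrier) :
  retract_interp [ffun _ : 'I_(ar o) => x] = x.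
Proof.
apply: val_inj => /=.
rewrite (_ : [ffun k => _] = [ffun _ => val x]); last first.
  by apply/ffunP => k; rewrite !ffunE.
rewrite algebra_idem; case: x => x /= /codomP[y ->]; exact: pp.
Qed.

Definition retract : algebra sig := Algebra retract_nonempty retract_idem.

End Retract.

(* Closure under homomorphic images makes [T] closed under isomorphism. *)
Definition M_template (T : algebra sig -> Prop) : Prop :=
  [/\ forall A B (h : A -> B),
        hom h -> (forall b, exists a, h a = b) -> T A -> T B,
      forall A B (h : B -> A), hom h -> injective h -> T A -> T B
    & forall A (p : A -> A) (pp : forall x, p (p x) = p x),
        unary_polynomial p -> T A -> T (retract pp)].

Definition congruence A (theta : rel A) : Prop :=
  [/\ reflexive theta, symmetric theta, transitive theta
    & forall (o : op sig) (u v : {ffun 'I_(ar o) -> A}),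
        (forall k, theta (u k) (v k)) -> theta (interp u) (interp v)].

Definition nonzero A (theta : rel A) : Prop :=
  exists x y, x != y /\ theta x y.

Definition is_monolith A (mu : rel A) : Prop :=
  [/\ congruence mu, nonzero mu
    & forall theta : rel A, congruence theta -> nonzero theta ->
        forall x y, mu x y -> theta x y].

(* One-element algebras, having no nonzero congruence, are excluded. *)
Definition subdirectly_irreducible A : Prop :=
  exists mu : rel A, is_monolith mu.

Definition centralizes A (alpha beta delta : rel A) : Prop :=
  forall (m n : nat) (t : term sig ('I_m + 'I_n))
    (a b : 'I_m -> A) (c d : 'I_n -> A),
    let T x y := eval (fun z => match z with inl k => x k | inr k => y k end) t in
    (forall k, alpha (a k) (b k)) -> (forall k, beta (c k) (d k)) ->
    delta (T a c) (T a d) -> delta (T b c) (T b d).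

Definition large_centralizer A (mu : rel A) : Prop :=
  centralizes (fun _ _ => true) mu (fun x y => x == y).

Section Quotient.
Variables (A : algebra sig) (theta : rel A).

Definition eq_class (x : A) : {set A} := [set y | theta x y].

Definition quotient_carrier : finType :=
  {X : {set A} | X \in [set eq_class x | x in [set: A]]}.

Lemma quotient_class_proof x : eq_class x \in [set eq_class x | x in [set: A]].
Proof. exact: imset_f. Qed.

Definition quotient_map (x : A) : quotient_carrier :=
  exist _ (eq_class x) (quotient_class_proof x).

Lemma quotient_repr_proof (X : quotient_carrier) :
  exists x, quotient_map x == X.
Proof. by case: X => X XP; have /imsetP[x _ E] := XP; exists x; rewrite -val_eqE /= E. Qed.

Definition quotient_repr (X : quotient_carrier) : A :=
  xchoose (quotient_repr_proof X).

Lemma quotient_reprK : cancel quotient_repr quotient_map.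
Proof. by move=> X; apply/eqP; exact: (xchooseP (quotient_repr_proof X)). Qed.

(* Representatives are chosen arbitrarily; [quotient_map_hom] shows that the
   choice does not matter when [theta] is a congruence. *)
Definition quotient_interp : interpretation sig quotient_carrier :=
  fun o v => quotient_map (interp [ffun k => quotient_repr (v k)]).

Lemma quotient_nonempty : 0 < #|quotient_carrier|.
Proof.
have /card_gt0P[x _] := algebra_nonempty A.
by apply/card_gt0P; exists (quotient_map x).
Qed.

Lemma quotient_idem (o : op sig) (X : quotient_carrier) :
  quotient_interp [ffun _ : 'I_(ar o) => X] = X.
Proof.
rewrite /quotient_interp (_ : [ffun k => _] = [ffun _ => quotient_repr X]).
  by rewrite algebra_idem quotient_reprK.
by apply/ffunP => k; rewrite !ffunE.
Qed.

Definition quotient : algebra sig := Algebra quotient_nonempty quotient_idem.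

Lemma quotient_mapP x y : congruence theta ->
  reflect (quotient_map x = quotient_map y) (theta x y).
Proof.
case=> r s t _; apply: (iffP idP) => [xy|/(congr1 val)/setP/(_ y)].
  apply: val_inj; apply/setP => z; rewrite !inE; apply/idP/idP; last exact: t.
  by apply: t; rewrite s.
by rewrite !inE r.
Qed.

Lemma quotient_map_hom : congruence theta ->
  @hom sig A quotient quotient_map.
Proof.
move=> cth; have [_ _ _ c] := cth; move=> o v.
apply/(quotient_mapP _ _ cth); apply: c => k.
by rewrite !ffunE; apply/(quotient_mapP _ _ cth); rewrite quotient_reprK.
Qed.

End Quotient.

Definition partial_assignment (V : finType) (D : V -> algebra sig)
    (S : {set V}) : finType :=
  {dffun forall i : {i : V | i \in S}, D (val i)}.

Definition constraint (V : finType) (D : V -> algebra sig) : finType :=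
  {S : {set V} & {set partial_assignment D S}}.

Record csp := Csp {
  var : finType;
  dom : var -> algebra sig;
  constraints : {set constraint dom}
}.

Definition subdirect (V : finType) (D : V -> algebra sig) (S : {set V})
    (R : {set partial_assignment D S}) : Prop :=
  [/\ R != set0,
      forall (o : op sig) (v : {ffun 'I_(ar o) -> partial_assignment D S}),
        (forall k, v k \in R) ->
        ([ffun i : {i : V | i \in S} => interp [ffun k => v k i]]
           : partial_assignment D S) \in R
    & forall (i : {i : V | i \in S}) (a : D (val i)),
        exists2 r : partial_assignment D S, r \in R & r i = a].

Definition csp_instance (T : algebra sig -> Prop) (P : csp) : Prop :=
  (forall i : var P, exists2 B, T B & isomorphic (dom i) B) /\
  (forall c : constraint (@dom P), c \in constraints P -> subdirect (tagged c)).

Definition SI_instance (T : algebra sig -> Prop) (P : csp) : Prop :=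
  csp_instance T P /\ forall i : var P, subdirectly_irreducible (dom i).

Definition solution (P : csp) (f : forall i : var P, dom i) : Prop :=
  forall c : constraint (@dom P), c \in constraints P ->
    ([ffun i : {i : var P | i \in tag c} => f (val i)]
       : partial_assignment (@dom P) (tag c)) \in tagged c.

Definition factor_domain (b : bool) A (mu : rel A) : algebra sig :=
  if b then quotient mu else A.

Definition factor_map (b : bool) A (mu : rel A) : A -> factor_domain b mu :=
  match b with
  | true => quotient_map mu
  | false => id
  end.

Section Factor.
Variables (P : csp) (mu : forall i : var P, rel (dom i)).
Arguments mu : clear implicits.

Definition is_large (i : var P) : bool := `[< large_centralizer (mu i) >].

Definition factored_dom (i : var P) : algebra sig :=
  factor_domain (is_large i) (mu i).

Definition factored_constraint (c : constraint (@dom P)) :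
    constraint factored_dom :=
  Tagged (fun S : {set var P} => {set partial_assignment factored_dom S})
    [set ([ffun i : {i : var P | i \in tag c} =>
             factor_map (is_large (val i)) (mu (val i)) (r i)]
            : partial_assignment factored_dom (tag c))
    | r : partial_assignment (@dom P) (tag c) in tagged c].

Definition factored : csp :=
  @Csp (var P) factored_dom [set factored_constraint c | c in constraints P].

End Factor.

Definition consistent (P : csp) (p : forall i : var P, dom i -> dom i) : Prop :=
  (forall i, unary_polynomial (p i)) /\
  forall c : constraint (@dom P), c \in constraints P ->
    forall r : partial_assignment (@dom P) (tag c), r \in tagged c ->
      ([ffun i : {i : var P | i \in tag c} => p (val i) (r i)]
         : partial_assignment (@dom P) (tag c)) \in tagged c.

Definition retractive (P : csp) (p : forall i : var P, dom i -> dom i) : Prop :=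
  forall i x, p i (p i x) = p i x.

Definition s_edge A (a b : A) : Prop :=
  exists t : term sig 'I_2,
    [/\ binary_op t a a = a, binary_op t a b = b,
        binary_op t b a = b & binary_op t b b = b].

Definition has_s_edge A : Prop := exists a b : A, a != b /\ s_edge a b.

Definition absorbs2 A (B : {set A}) : Prop :=
  subuniverse B /\
  exists t : term sig 'I_2, forall x y : A,
    (x \in B) || (y \in B) -> binary_op t x y \in B.

End MoreAlgebras.

(* Main.v *)
Require Import Defs.
From mathcomp Require Import all_boot.
From mathcomp Require Import boolp.

(** A binary term [t] is iterated in its second variable until it satisfies
    [u(x, u(x, y)) = u(x, y)] on all domains. If [x] and [y] are in one class of
    the monolith of a large centralizer domain, the centralizer condition cancels
    [u(x, _)] to give [u(z, u(x, y)) = u(z, y)] for all [z]; hence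
    [s(x, y) = u(x, u(y, x))] is the first projection on that class, and, by the
    centralizer condition again, [s(z, y)] depends only on [z] and the class of
    [y]. So a solution [f] of the factored instance gives the consistent maps
    [x |-> s(x, f(j))]. If [t] is a semilattice operation on [a -> b], so is [s],
    and for [f(i) = b] the [i]-th map identifies [a] and [b]; if [t] witnesses
    absorption of [B], so does [s], and for [f(i)] the class of a point of [B]
    the [i]-th map has its range in [B]. Composing such maps over all [i] and
    taking an idempotent power makes them retractive. *)

Set Implicit Arguments.
Unset Strict Implicit.
Unset Printing Implicit Defensive.

(** * Idempotent powers of maps on finite sets *)

Lemma iter_fact_idem (U : finType) (f : U -> U) (m : nat) (x : U) :
  #|U| <= m -> iter m`! f (iter m`! f x) = iter m`! f x.
Proof.
move=> leUm; have := looping_order f x.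
rewrite /looping => /trajectP[i lt_i E].
have le_o : fingraph.order f x <= m by apply: leq_trans leUm; apply: max_card.
set o := fingraph.order f x in lt_i E le_o.
(* From step [i] on, the orbit of [x] has period [o - i]. The factorial of [m] is at least [i] and a
   multiple of this period. *)
have step k : i <= k -> iter (k + (o - i)) f x = iter k f x.
  move=> le_ik; rewrite -(subnK le_ik) -addnA subnKC; last exact: ltnW.
  by rewrite !iterD E.
have le_im : i <= m`!.
  by apply: leq_trans (ltnW lt_i) (leq_trans le_o _); apply: fact_geq.
have /dvdnP[q Eq] : o - i %| m`!.
  by apply: dvdn_fact; rewrite subn_gt0 lt_i (leq_trans (leq_subr _ _)).
rewrite -iterD {2}Eq; elim: q {Eq} => [|q IHq]; first by rewrite addn0.
by rewrite mulSn addnCA addnC step // (leq_trans le_im) // leq_addr.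
Qed.

Lemma image_proper_noninj (U : finType) (f : U -> U) :
  ~ injective f -> [set f x | x in [set: U]] \proper [set: U].
Proof.
move=> ninj; rewrite properEneq subsetT andbT; apply/eqP => fT; apply: ninj.
have /imset_injP fI : #|f @: [set: U]| == #|[set: U]| by rewrite fT.
by move=> x y; apply: fI; rewrite inE.
Qed.

(** * Binary terms: iteration, twisting, centralizers and absorption *)

Section Terms.
Variable sig : signature.
Implicit Types A B : algebra sig.

Fixpoint subst (X Y : Type) (s : X -> term sig Y) (t : term sig X) :
    term sig Y :=
  match t with
  | Var x => s x
  | App o ts => @App sig Y o (fun k => subst s (ts k))
  end.

Lemma eval_App A (X : Type) (v : X -> A) o (ts : 'I_(ar o) -> term sig X) :
  eval v (App ts) = interp [ffun k => eval v (ts k)].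
Proof. by []. Qed.

Lemma eval_subst A (X Y : Type) (s : X -> term sig Y) (v : Y -> A) t :
  eval v (subst s t) = eval (fun x => eval v (s x)) t.
Proof.
elim: t => // o ts IH; rewrite /= !eval_App; congr interp.
by apply/ffunP => k; rewrite !ffunE.
Qed.

Lemma eval_ext A (X : Type) (v w : X -> A) (t : term sig X) :
  v =1 w -> eval v t = eval w t.
Proof.
move=> vw; elim: t => [x|o ts IH]; first exact: vw.
by rewrite !eval_App; congr interp; apply/ffunP => k; rewrite !ffunE.
Qed.

Lemma eval_const A (X : Type) (a : A) (t : term sig X) :
  eval (fun=> a) t = a.
Proof.
elim: t => // o ts IH; rewrite eval_App -[RHS](algebra_idem o).
by congr interp; apply/ffunP => k; rewrite !ffunE.
Qed.

Lemma eval_cong A (theta : rel A) (X : Type) (v w : X -> A) (t : term sig X) :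
  congruence theta -> (forall x, theta (v x) (w x)) ->
  theta (eval v t) (eval w t).
Proof.
move=> [_ _ _ c] vw; elim: t => [x|o ts IH]; first exact: vw.
by rewrite !eval_App; apply: c => k; rewrite !ffunE.
Qed.

Definition bsub (X : Type) (t : term sig 'I_2) (u v : term sig X) :=
  subst (fun k : 'I_2 => if val k == 0 then u else v) t.

Lemma eval_bsub A (X : Type) (e : X -> A) t u v :
  eval e (bsub t u v) = binary_op t (eval e u) (eval e v).
Proof. by rewrite eval_subst; apply: eval_ext => k; case: ifP. Qed.

Lemma binary_op_idem A (t : term sig 'I_2) (x : A) : binary_op t x x = x.
Proof. by rewrite -[RHS](eval_const x t); apply: eval_ext => k; case: ifP. Qed.

Lemma binary_op_cong A (theta : rel A) (t : term sig 'I_2) x x' y y' :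
  congruence theta -> theta x x' -> theta y y' ->
  theta (binary_op t x y) (binary_op t x' y').
Proof. by move=> cth xx' yy'; apply: eval_cong => // k; case: ifP. Qed.

(** The first congruence in the centralizer condition is full, so [x] may be exchanged for an
    arbitrary [x']. *)
Lemma centralizes_binary A (mu : rel A) (t : term sig 'I_2) x x' y y' :
  large_centralizer mu -> mu y y' ->
  binary_op t x y = binary_op t x y' -> binary_op t x' y = binary_op t x' y'.
Proof.
move=> C yy' E.
have := C 1 1 (bsub t (Var sig (inl ord0)) (Var sig (inr ord0)))
  (fun=> x) (fun=> x') (fun=> y) (fun=> y') (fun=> erefl) (fun=> yy').
by rewrite /= !eval_bsub /= E eqxx => /(_ erefl)/eqP.
Qed.

Definition iter_term (n : nat) (t : term sig 'I_2) : term sig 'I_2 :=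
  iter n (bsub t (Var sig ord0)) (Var sig ord_max).

Lemma binary_op_iter_term A n t (x y : A) :
  binary_op (iter_term n t) x y = iter n (binary_op t x) y.
Proof.
rewrite {1}/binary_op /iter_term; elim: n => //= n IHn.
by rewrite eval_bsub IHn.
Qed.

(** The passage from [u] to [s(x, y) = u(x, u(y, x))]. *)
Definition twist (t : term sig 'I_2) : term sig 'I_2 :=
  bsub t (Var sig ord0) (bsub t (Var sig ord_max) (Var sig ord0)).

Lemma binary_op_twist A t (x y : A) :
  binary_op (twist t) x y = binary_op t x (binary_op t y x).
Proof. by rewrite {1}/binary_op !eval_bsub. Qed.

Lemma twist_blind A (mu : rel A) (t : term sig 'I_2) :
  congruence mu -> large_centralizer mu ->
  (forall x y : A, binary_op t x (binary_op t x y) = binary_op t x y) ->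
  forall z x y : A, mu x y ->
    binary_op (twist t) z x = binary_op (twist t) z y.
Proof.
move=> cmu C tt z x y xy; have [mu_refl mu_sym _ _] := cmu.
suff tw : binary_op (twist t) x y = x.
  by apply: (centralizes_binary (x := x) _ C xy); rewrite tw binary_op_idem.
(* With [x] on the right written as [t(x, x)], the outer first argument [x] may be exchanged for
   [y]; what remains is [t(y, t(y, x)) = t(y, x)]. *)
rewrite binary_op_twist -[RHS](binary_op_idem t).
apply: (centralizes_binary (x := y) _ C); last exact: tt.
by rewrite -{2}[x](binary_op_idem t); apply: binary_op_cong => //; rewrite mu_sym.
Qed.

Lemma s_edge_iter A n t (a b : A) : 0 < n ->
  binary_op t a b = b -> binary_op t b a = b ->
  binary_op (iter_term n t) a b = b /\ binary_op (iter_term n t) b a = b.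
Proof.
move=> n0 ab ba; rewrite !binary_op_iter_term; split.
  by elim: n {n0} => //= n ->.
(* The innermost application turns [a] into [b], which the others fix; for [n = 0] the value would
   be [a]. *)
case: n n0 => // n _; rewrite iterSr ba.
by elim: n => //= n ->; rewrite binary_op_idem.
Qed.

Definition absorbing_term A (B : {set A}) (t : term sig 'I_2) : Prop :=
  forall x y : A, (x \in B) || (y \in B) -> binary_op t x y \in B.

Lemma absorbing_iter A (B : {set A}) n t : 0 < n ->
  absorbing_term B t -> absorbing_term B (iter_term n t).
Proof.
move=> n0 tB x y xy; rewrite binary_op_iter_term.
case: n n0 => // n _; rewrite iterSr.
by elim: n => /= [|n IHn]; apply: tB => //; rewrite IHn orbT.
Qed.

Lemma absorbing_twist A (B : {set A}) t :
  absorbing_term B t -> absorbing_term B (twist t).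
Proof.
by move=> tB x y xy; rewrite binary_op_twist !tB ?orbT // orbC.
Qed.

Lemma unary_polynomial_id A : @unary_polynomial sig A id.
Proof. by exists (Var sig None). Qed.

Lemma unary_polynomial_comp A (p q : A -> A) :
  unary_polynomial p -> unary_polynomial q -> unary_polynomial (p \o q).
Proof.
move=> [t pt] [u qu].
exists (subst (fun z => if z is Some a then Var sig (Some a) else u) t) => x /=.
by rewrite pt qu eval_subst; apply: eval_ext; case.
Qed.

Lemma unary_polynomial_binary A t (c : A) :
  unary_polynomial (fun x => binary_op t x c).
Proof.
by exists (bsub t (Var sig None) (Var sig (Some c))) => x; rewrite eval_bsub.
Qed.

Lemma subdirect_binary (V : finType) (D : V -> algebra sig) (S : {set V})
    (R : {set partial_assignment D S}) t (r r' : partial_assignment D S) :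
  subdirect R -> r \in R -> r' \in R ->
  ([ffun i : {i : V | i \in S} => binary_op t (r i) (r' i)]
     : partial_assignment D S) \in R.
Proof.
move=> [_ Rop _] rR r'R; rewrite /binary_op.
elim: t => [k|o ts IH].
  have [k0|k0] := boolP (val k == 0).
    rewrite (_ : finfun _ = r) //; apply/ffunP => i.
    by move: k0; rewrite ffunE /eval /= => ->.
  rewrite (_ : finfun _ = r') //; apply/ffunP => i.
  by move: k0; rewrite ffunE /eval /= => /negPf ->.
pose w := [ffun k => ([ffun i : {i : V | i \in S} =>
  eval (fun z : 'I_2 => if val z == 0 then r i else r' i) (ts k)]
    : partial_assignment D S)].
have := Rop o w; rewrite (_ : finfun _ = [ffun i => eval
   (fun k : 'I_2 => if val k == 0 then r i else r' i) (App ts)]).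
  by apply=> k; rewrite ffunE; apply: IH.
apply/ffunP => i; rewrite !ffunE /=; congr interp.
by apply/ffunP => k; rewrite !ffunE.
Qed.

End Terms.

(** * Consistent maps from solutions of the factored instance *)

Section ConsistentMaps.
Variables (sig : signature) (T : algebra sig -> Prop) (P : csp sig).
Variable mu : forall i : var P, rel (dom i).
Arguments mu : clear implicits.
Hypothesis PT : csp_instance T P.
Hypothesis muP : forall i : var P, congruence (mu i).

(** A section of [factor_map], split on the same boolean so that the types agree. *)
Definition factor_repr (b : bool) (A : algebra sig) (th : rel A) :
    factor_domain b th -> A :=
  match b with
  | true => @quotient_repr sig A th
  | false => id
  end.

(** The second argument of [t] then only matters through its image in the factored domain. *)
Definition blind (t : term sig 'I_2) : Prop :=
  forall i : var P, large_centralizer (mu i) ->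
    forall z x y : dom i, mu i x y -> binary_op t z x = binary_op t z y.

Lemma blind_repr t (i : var P) (x y : dom i) : blind t ->
  binary_op t x (factor_repr (factor_map (is_large mu i) (mu i) y)) =
  binary_op t x y.
Proof.
move=> tb; have := tb i; rewrite /is_large; case: asboolP => //= L /(_ L)tbi.
by apply: tbi; apply/(quotient_mapP _ _ (muP i)); rewrite quotient_reprK.
Qed.

Lemma consistent_translation t (f : forall i : var (factored mu), dom i) :
  blind t -> solution f ->
  consistent (fun (i : var P) x => binary_op t x (factor_repr (f i))).
Proof.
move=> tb fs; split=> [i|c cP r rR]; first exact: unary_polynomial_binary.
have := fs (factored_constraint mu c) (imset_f _ cP).
(* The representatives of [f] need not form a tuple of the constraint relation, but some [r'] in it
   lies over [f]; blindness lets [r'] replace them. *)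
case/imsetP=> r' r'R /ffunP Ef.
rewrite (_ : finfun _ = [ffun i => binary_op t (r i) (r' i)]); last first.
  apply/ffunP => i; rewrite !ffunE; have := Ef i; rewrite !ffunE => ->.
  exact: blind_repr.
by apply: subdirect_binary => //; apply: PT.2.
Qed.

Lemma consistent_id : consistent (fun (i : var P) (x : dom i) => x).
Proof.
split=> [i|c cP r rR]; first exact: unary_polynomial_id.
by rewrite (_ : finfun _ = r) //; apply/ffunP => i; rewrite ffunE.
Qed.

Lemma consistent_comp (p q : forall i : var P, dom i -> dom i) :
  consistent p -> consistent q -> consistent (fun i => p i \o q i).
Proof.
move=> [pp pc] [qp qc]; split=> [i|c cP r rR].
  exact: unary_polynomial_comp.
have := pc c cP _ (qc c cP r rR); set u := (X in X \in _ -> _) => uR.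
by rewrite (_ : finfun _ = u) //; apply/ffunP => i; rewrite !ffunE.
Qed.

Lemma consistent_iter (p : forall i : var P, dom i -> dom i) n :
  consistent p -> consistent (fun i => iter n (p i)).
Proof.
move=> pc; elim: n => [|n IHn]; first exact: consistent_id.
exact: (consistent_comp pc IHn).
Qed.

Lemma consistent_solution (p : forall i : var P, dom i -> dom i)
    (f : forall i : var P, dom i) :
  consistent p -> solution f -> solution (fun i => p i (f i)).
Proof.
move=> [_ pc] fs c cP; have := pc c cP _ (fs c cP).
set u := (X in X \in _ -> _) => uR.
by rewrite (_ : finfun _ = u) //; apply/ffunP => i; rewrite !ffunE.
Qed.

(** One exponent that makes every self-map of every domain idempotent. *)
Definition power : nat := (\max_(i : var P) #|dom i|)`!.

Lemma power_idem (i : var P) (f : dom i -> dom i) x :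
  iter power f (iter power f x) = iter power f x.
Proof. exact/iter_fact_idem/(leq_bigmax (F := fun i : var P => #|dom i|)). Qed.

Lemma blind_twist t : blind (twist (iter_term power t)).
Proof.
move=> i L; apply: twist_blind => // x y.
by rewrite !binary_op_iter_term power_idem.
Qed.

(** * Collapsing s-edges and moving solutions into absorbing subalgebras *)

Hypothesis factored_solvable :
  forall (i : var (factored mu)) (a : dom i),
    exists f : forall j : var (factored mu), dom j, solution f /\ f i = a.

Lemma consistent_through t (i : var P) (a : dom i) : blind t ->
  exists2 p : forall i : var P, dom i -> dom i,
    consistent p & forall x, p i x = binary_op t x a.
Proof.
move=> tb; have [f [fs fa]] :=
  factored_solvable (i := i) (factor_map (is_large mu i) (mu i) a).
exists (fun (j : var P) x => binary_op t x (factor_repr (f j))).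
  exact: consistent_translation.
by move=> x; rewrite fa blind_repr.
Qed.

Lemma consistent_noninjective (i : var P) : has_s_edge (dom i) ->
  exists2 p : forall i : var P, dom i -> dom i,
    consistent p & ~ injective (p i).
Proof.
move=> [a [b [/eqP nab [t [_ ab ba _]]]]].
have [uab uba] := s_edge_iter (fact_gt0 _ : 0 < power) ab ba.
have [p pc pE] := consistent_through b (blind_twist t).
exists p => // pI; apply/nab/pI.
(* [s(a, b) = u(a, u(b, a)) = u(a, b) = b = s(b, b)]. *)
by rewrite !pE !binary_op_twist uba uab !binary_op_idem.
Qed.

Lemma consistent_all_noninjective (l : seq (var P)) :
  exists2 p : forall i : var P, dom i -> dom i,
    consistent p & forall i, i \in l -> has_s_edge (dom i) -> ~ injective (p i).
Proof.
elim: l => [|i l [q qc qI]].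
  by exists (fun _ x => x) => //; exact: consistent_id.
have [/consistent_noninjective[p pc pI]|nse] := pselect (has_s_edge (dom i)).
  exists (fun j => p j \o q j); first exact: consistent_comp.
  move=> j; rewrite inE => /predU1P[-> _|jl se] pqI.
    (* If the composite is injective, so is [q j], which is then bijective by finiteness; cancelling
       it makes [p j] injective. *)
    have [g gK Kg] := injF_bij (inj_compr pqI).
    by apply: pI; apply: eq_inj (inj_comp pqI (can_inj Kg)) _ => x /=; rewrite Kg.
  exact: qI jl se (inj_compr pqI).
by exists q => // j; rewrite inE => /predU1P[-> //|]; exact: qI.
Qed.

Lemma retractive_consistent :
  exists p : forall i : var P, dom i -> dom i,
    [/\ consistent p, retractive p
      & forall i : var P, has_s_edge (dom i) ->
          [set p i x | x in [set: dom i]] \proper [set: dom i]].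
Proof.
have [q qc qI] := consistent_all_noninjective (enum (var P)).
exists (fun i => iter power (q i)); split.
- exact: consistent_iter.
- by move=> i x; exact: power_idem.
move=> i se; apply: image_proper_noninj => pI.
apply: (qI i _ se); first by rewrite mem_enum.
(* Since the exponent is positive, the iterate applies [q i] first and inherits its collapsed
   pairs. *)
case: power (fact_gt0 _ : 0 < power) pI => // n _ pI x y xy.
by apply: pI; rewrite !iterSr xy.
Qed.

Lemma solution_in_absorbing (i : var P) (B : {set dom i})
    (f : forall i : var P, dom i) :
  absorbs2 B -> solution f ->
  exists g : forall i : var P, dom i, solution g /\ g i \in B.
Proof.
move=> [[/set0Pn[b bB] _] [t tB]] fs.
(* The [i]-th map is [s(x, b)] with [b] in [B], so absorption puts all its values in [B]. *)
have [p pc pE] := consistent_through b (blind_twist t).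
exists (fun j => p j (f j)); split; first exact: consistent_solution.
rewrite pE; apply: absorbing_twist; last by rewrite bB orbT.
by apply: absorbing_iter => //; exact: fact_gt0.
Qed.

End ConsistentMaps.

Theorem theorem42 (sig : signature) (T : algebra sig -> Prop) (P : csp sig)
    (mu : forall i : var P, rel (dom i)) :
  M_template T ->
  (forall A : algebra sig, T A -> minimal_taylor A) ->
  SI_instance T P ->
  (forall i : var P, is_monolith (mu i)) ->
  (forall (i : var (factored mu)) (a : dom i),
     exists f : forall j : var (factored mu), dom j, solution f /\ f i = a) ->
  (exists p : forall i : var P, dom i -> dom i,
     [/\ consistent p, retractive p
       & forall i : var P, large_centralizer (mu i) -> has_s_edge (dom i) ->
           [set p i x | x in [set: dom i]] \proper [set: dom i]])
  /\
  (forall (i : var P) (B : {set dom i}),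
     large_centralizer (mu i) -> absorbs2 B ->
     ((exists f : forall j : var P, dom j, solution f) <->
      (exists f : forall j : var P, dom j, solution f /\ f i \in B))).
Proof.
move=> _ _ [PT _] mono solv.
have muP i : congruence (mu i) by case: (mono i).
split.
  have [p [pc pr pI]] := retractive_consistent PT muP solv.
  by exists p; split=> // i _; exact: pI.
move=> i B _ absB; split=> [[f fs]|[f [fs _]]]; last by exists f.
exact: (solution_in_absorbing PT muP solv absB fs).
Qed.
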